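(* For any $\gamma,\alpha\in(0,1)$, there exists $\delta_{\gamma,\alpha}>0$ such that $\omega^*(\mathrm{CLONE}_{\gamma,\alpha})\le (1-\gamma)+\gamma\,\omega^*(\mathrm{CHSH})-\delta_{\gamma,\alpha}$.
   Context: $\omega^*(G)$ denotes the quantum value (supremum of winning probabilities over quantum strategies) of a game $G$. $\omega^*(\mathrm{CHSH})=\frac12\left(1+\frac1{\sqrt2}\right)$ is the quantum value of the CHSH game (inputs $x,y\in\{0,1\}$ uniform, outputs $a,b\in\{0,1\}$, win iff $a\oplus b=x\cdot y$). The game $\mathrm{CLONE}_{\gamma,\alpha}$ has four players Alice, Barlie, Bob, Charlie. Initially Alice and Barlie share an arbitrary entangled state. Round 1 (no communication): Alice receives uniform $x\in\{0,1\}$; Barlie independently receives $u\in\{0,1,\mathrm{keep}\}$ with $\Pr[u=\mathrm{keep}]=1-\gamma$, $\Pr[u=0]=\Pr[u=1]=\gamma/2$; Alice outputs $a\in\{0,1\}$ and Barlie outputs $s\in\{0,1\}$. Then Barlie applies an arbitrary channel to his registers and distributes the result between Bob and Charlie, who do not communicate afterwards. Round 2: Bob receives $y$ and Charlie receives $z$, where independently $y=\perp$ with probability $\alpha$ and $y=x$ otherwise, and likewise $z=\perp$ with probability $\alpha$ and $z=x$ otherwise; they output $b,c\in\{0,1\}$. The players win iff either ($u\neq\mathrm{keep}$ and $a\oplus s=x\cdot u$) or ($u=\mathrm{keep}$ and ($y=\perp$ or $z=\perp$ or $b=c=a$)). *)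

(* Defs.v *)
From HB Require Import structures.
From mathcomp Require Import all_boot all_order all_algebra.
From mathcomp Require Import complex.
From mathcomp Require Import classical_sets reals.

Set Implicit Arguments.
Unset Strict Implicit.
Unset Printing Implicit Defensive.

Import Order.TTheory GRing.Theory Num.Theory.
Local Open Scope ring_scope.
Local Open Scope classical_set_scope.

Section Quantum.
Variable R : realType.
Local Notation C := R[i].

Definition adjmx m n (M : 'M[C]_(m, n)) : 'M[C]_(n, m) := (map_mx Num.conj M)^T.

Definition psdmx n (M : 'M[C]_n) : Prop :=
  M = adjmx M /\ forall v : 'rV[C]_n, 0 <= (v *m M *m adjmx v) 0 0.

Definition density n (rho : 'M[C]_n) : Prop := psdmx rho /\ \tr rho = 1.

Definition povm (I : finType) n (E : I -> 'M[C]_n) : Prop :=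
  (forall i, psdmx (E i)) /\ \sum_(i : I) E i = 1%:M.

(* Kronecker (tensor) product; the index of 'I_(m*n) is decoded as a pair
   ('I_m * 'I_n) with the library's bijection used by mxvec *)
Definition kidx m n (k : 'I_(m * n)) : 'I_m * 'I_n :=
  enum_val (cast_ord (esym (mxvec_cast m n)) k).

Definition kron m1 n1 m2 n2 (A : 'M[C]_(m1, n1)) (B : 'M[C]_(m2, n2))
  : 'M[C]_(m1 * m2, n1 * n2) :=
  \matrix_(i, j) (A (kidx i).1 (kidx j).1 * B (kidx i).2 (kidx j).2).

(* A quantum instrument from an n-dimensional system to an m-dimensional one,
   with classical outcomes in S, given by Kraus operators K s k
   (CP maps X |-> sum_k K s k X (K s k)^*, summing to a trace-preserving map) *)
Definition instrument (S : finType) m n k (K : S -> 'I_k -> 'M[C]_(m, n)) : Prop :=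
  \sum_(s : S) \sum_(j < k) adjmx (K s j) *m K s j = 1%:M.

Definition apply_instr (S : finType) dA m n k (K : S -> 'I_k -> 'M[C]_(m, n))
  (s : S) (rho : 'M[C]_(dA * n)) : 'M[C]_(dA * m) :=
  \sum_(j < k) (kron 1%:M (K s j) *m rho *m adjmx (kron 1%:M (K s j))).

Record chsh_strategy (dA dB : nat) := ChshStrategy {
  chsh_rho : 'M[C]_(dA * dB);
  chsh_A : bool -> bool -> 'M[C]_dA;   (* input x, output a *)
  chsh_B : bool -> bool -> 'M[C]_dB }. (* input y, output b *)

Definition chsh_valid dA dB (S : chsh_strategy dA dB) : Prop :=
  density (chsh_rho S) /\ (forall x, povm (chsh_A S x)) /\
  (forall y, povm (chsh_B S y)).

Definition chsh_winprob dA dB (S : chsh_strategy dA dB) : R :=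
  \sum_(x : bool) \sum_(y : bool) \sum_(a : bool) \sum_(b : bool)
    (if addb a b == x && y then 4^-1 else 0) *
    complex.Re (\tr (kron (chsh_A S x a) (chsh_B S y b) *m chsh_rho S)).

Definition chsh_qvalue : R :=
  sup [set p | exists (dA dB : nat) (S : chsh_strategy dA dB),
                 chsh_valid S /\ p = chsh_winprob S].

(* Barlie's input u : option bool, with None = keep;
   Bob/Charlie inputs y, z : option bool, with None = bottom. *)

Record clone_strategy (dA dB dBo dCh nK : nat) := CloneStrategy {
  cl_rho : 'M[C]_(dA * dB);                       (* Alice-Barlie state *)
  cl_A : bool -> bool -> 'M[C]_dA;                (* x, a *)
  cl_K : option bool -> bool -> 'I_nK -> 'M[C]_(dBo * dCh, dB);
      (* for input u, Barlie's instrument: outcome s, Kraus index;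
         output space = Bob (x) Charlie *)
  cl_Bob : option bool -> bool -> 'M[C]_dBo;      (* y, b *)
  cl_Charlie : option bool -> bool -> 'M[C]_dCh }. (* z, c *)

Definition clone_valid dA dB dBo dCh nK (S : clone_strategy dA dB dBo dCh nK)
  : Prop :=
  density (cl_rho S) /\ (forall x, povm (cl_A S x)) /\
  (forall u, instrument (cl_K S u)) /\
  (forall y, povm (cl_Bob S y)) /\ (forall z, povm (cl_Charlie S z)).

Definition clone_win (x : bool) (u : option bool) (a s : bool)
  (y z : option bool) (b c : bool) : bool :=
  match u with
  | Some u' => addb a s == x && u'
  | None => [|| y == None, z == None | (b == a) && (c == a)]
  end.

Definition prob_u (g : R) (u : option bool) : R :=
  if u is Some _ then g / 2 else 1 - g.

Definition prob_y (al : R) (x : bool) (y : option bool) : R :=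
  match y with None => al | Some t => if t == x then 1 - al else 0 end.

Definition clone_winprob (g al : R) dA dB dBo dCh nK
  (S : clone_strategy dA dB dBo dCh nK) : R :=
  \sum_(x : bool) \sum_(u : option bool) \sum_(y : option bool)
  \sum_(z : option bool) \sum_(a : bool) \sum_(s : bool) \sum_(b : bool)
  \sum_(c : bool)
    (2^-1 * prob_u g u * prob_y al x y * prob_y al x z) *
    (if clone_win x u a s y z b c then 1 else 0) *
    complex.Re (\tr (kron (cl_A S x a) (kron (cl_Bob S y b) (cl_Charlie S z c))
             *m apply_instr (cl_K S u) s (cl_rho S))).

Definition clone_qvalue (g al : R) : R :=
  sup [set p | exists (dA dB dBo dCh nK : nat)
                 (S : clone_strategy dA dB dBo dCh nK),
                 clone_valid S /\ p = clone_winprob g al S].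

End Quantum.

(* Main.v *)
(* For a state rho, sqn X := Re tr (X rho adj(X)) is the square of a seminorm that
   left multiplication by an observable E_0 - E_1 does not increase.  Write A_0, A_1
   for Alice's observables and S_0, S_1 for Barlie's, eta for sqrt 2 times the
   defect of the CHSH correlation from 2 sqrt 2, and kappa for the probability that
   Bob and Charlie, both given x, do not both guess Alice's bit in the keep round.
   - The sum-of-squares proof of Tsirelson's bound shows that sqn is O(eta) on
     sqrt 2 S_0 - (A_0 + A_1), A_x^2 - 1 and S_u^2 - 1, hence on the anticommutator
     of A_0 and A_1.
   - In the keep round sqn is O(kappa) on the difference of A_0 and Bob's observable
     for x = 0, and of A_1 and Charlie's for x = 1.  As Bob's and Charlie's
     observables commute, sqn is O(kappa) on the commutator of A_0 and A_1.
   Since sqn (A_1 A_0) is then close to 1, this gives 1 <= 100 eta + 168 kappa, while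
   the winning probability is exactly
   (1 - gamma) + gamma (1/2 + sqrt 2 / 4)
     - (1 - gamma) (1 - alpha)^2 kappa - (gamma sqrt 2 / 16) eta.
   Finally the value 1/2 + sqrt 2 / 4 is attained in CHSH. *)

Require Import Defs.
From HB Require Import structures.
From mathcomp Require Import all_boot all_order all_algebra.
From mathcomp Require Import complex.
From mathcomp Require Import classical_sets reals.
From mathcomp Require Import ring lra.
Import Order.TTheory GRing.Theory Num.Theory.
Local Open Scope ring_scope.

Set Implicit Arguments.
Unset Strict Implicit.
Unset Printing Implicit Defensive.

(** * Kronecker products, adjoints and positive semidefinite matrices *)

Section Matrices.
Variable R : realType.
Local Notation C := R[i].

Lemma kidx_mxvec_index m n (i : 'I_m) (j : 'I_n) :
  kidx (mxvec_index i j) = (i, j).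
Proof. by rewrite /kidx /mxvec_index cast_ordK enum_rankK. Qed.

Lemma sum_kidx m n (F : 'I_m -> 'I_n -> C) :
  \sum_(k < m * n) F (kidx k).1 (kidx k).2 = \sum_i \sum_j F i j.
Proof.
rewrite pair_big (reindex _ (curry_mxvec_bij _ _)) /=.
by apply: eq_bigr => -[i j] _; rewrite /= kidx_mxvec_index.
Qed.

Lemma kron_mulmx m1 n1 p1 m2 n2 p2 (A : 'M[C]_(m1, n1)) (B : 'M[C]_(m2, n2))
    (A' : 'M[C]_(n1, p1)) (B' : 'M[C]_(n2, p2)) :
  kron A B *m kron A' B' = kron (A *m A') (B *m B').
Proof.
apply/matrixP => i j; rewrite !mxE.
under eq_bigr do rewrite !mxE.
rewrite (sum_kidx (fun k l => A (kidx i).1 k * B (kidx i).2 l *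
  (A' k (kidx j).1 * B' l (kidx j).2))).
rewrite mulr_suml; apply: eq_bigr => k _.
by rewrite mulr_sumr; apply: eq_bigr => l _; rewrite mulrACA.
Qed.

Lemma kron_linearl m1 n1 m2 n2 (B : 'M[C]_(m2, n2)) :
  linear (fun A : 'M[C]_(m1, n1) => kron A B).
Proof. by move=> c A A'; apply/matrixP => i j; rewrite !mxE mulrDl mulrA. Qed.

Lemma kron_linearr m1 n1 m2 n2 (A : 'M[C]_(m1, n1)) :
  linear (kron A : 'M[C]_(m2, n2) -> _).
Proof.
by move=> c B B'; apply/matrixP => i j; rewrite !mxE mulrDr mulrCA.
Qed.

HB.instance Definition _ m1 n1 m2 n2 (A : 'M[C]_(m1, n1)) :=
  GRing.isLinear.Build C 'M[C]_(m2, n2) 'M[C]_(m1 * m2, n1 * n2) *:%R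
    (kron A) (@kron_linearr m1 n1 m2 n2 A).

Definition kronl m1 n1 m2 n2 (B : 'M[C]_(m2, n2)) (A : 'M[C]_(m1, n1)) := kron A B.

HB.instance Definition _ m1 n1 m2 n2 (B : 'M[C]_(m2, n2)) :=
  GRing.isLinear.Build C 'M[C]_(m1, n1) 'M[C]_(m1 * m2, n1 * n2) *:%R
    (kronl B) (@kron_linearl m1 n1 m2 n2 B).

Lemma kronBl m1 n1 m2 n2 (A A' : 'M[C]_(m1, n1)) (B : 'M[C]_(m2, n2)) :
  kron (A - A') B = kron A B - kron A' B.
Proof. exact: (raddfB (kronl B)). Qed.

Lemma kronDl m1 n1 m2 n2 (A A' : 'M[C]_(m1, n1)) (B : 'M[C]_(m2, n2)) :
  kron (A + A') B = kron A B + kron A' B.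
Proof. exact: (raddfD (kronl B)). Qed.

Lemma kron_suml I (r : seq I) P m1 n1 m2 n2 (A : I -> 'M[C]_(m1, n1))
    (B : 'M[C]_(m2, n2)) :
  kron (\sum_(i <- r | P i) A i) B = \sum_(i <- r | P i) kron (A i) B.
Proof. exact: (raddf_sum (kronl B)). Qed.

Lemma kronBr m1 n1 m2 n2 (A : 'M[C]_(m1, n1)) (B B' : 'M[C]_(m2, n2)) :
  kron A (B - B') = kron A B - kron A B'.
Proof. exact: raddfB. Qed.

Lemma kron_sumr I (r : seq I) P m1 n1 m2 n2 (A : 'M[C]_(m1, n1))
    (B : I -> 'M[C]_(m2, n2)) :
  kron A (\sum_(i <- r | P i) B i) = \sum_(i <- r | P i) kron A (B i).
Proof. exact: raddf_sum. Qed.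

Lemma kron11 m n : kron (1%:M : 'M[C]_m) (1%:M : 'M[C]_n) = 1%:M.
Proof.
apply/matrixP => i j; rewrite !mxE.
case/mxvec_indexP: i => i1 i2; case/mxvec_indexP: j => j1 j2.
rewrite !kidx_mxvec_index /= -natrM mulnb; congr (_%:R); congr nat_of_bool.
apply/idP/eqP => [/andP[/eqP -> /eqP ->] //|].
by move=> /(congr1 (@kidx m n)); rewrite !kidx_mxvec_index => -[-> ->]; rewrite !eqxx.
Qed.

Lemma adjmxK m n (M : 'M[C]_(m, n)) : adjmx (adjmx M) = M.
Proof. by apply/matrixP => i j; rewrite !mxE conjCK. Qed.

Lemma adjmxM m n p (M : 'M[C]_(m, n)) (N : 'M[C]_(n, p)) :
  adjmx (M *m N) = adjmx N *m adjmx M.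
Proof. by rewrite /adjmx map_mxM trmx_mul. Qed.

Lemma adjmxD m n (M N : 'M[C]_(m, n)) : adjmx (M + N) = adjmx M + adjmx N.
Proof. by rewrite /adjmx map_mxD linearD. Qed.

Lemma adjmxN m n (M : 'M[C]_(m, n)) : adjmx (- M) = - adjmx M.
Proof. by rewrite /adjmx map_mxN linearN. Qed.

Lemma adjmxB m n (M N : 'M[C]_(m, n)) : adjmx (M - N) = adjmx M - adjmx N.
Proof. by rewrite adjmxD adjmxN. Qed.

Lemma adjmxZ m n c (M : 'M[C]_(m, n)) : adjmx (c *: M) = Num.conj c *: adjmx M.
Proof. by apply/matrixP => i j; rewrite !mxE rmorphM. Qed.

Lemma adjmx1 n : adjmx (1%:M : 'M[C]_n) = 1%:M.
Proof. by rewrite /adjmx map_mx1 trmx1. Qed.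

Lemma adjmx_kron m1 n1 m2 n2 (A : 'M[C]_(m1, n1)) (B : 'M[C]_(m2, n2)) :
  adjmx (kron A B) = kron (adjmx A) (adjmx B).
Proof. by apply/matrixP => i j; rewrite !mxE rmorphM. Qed.

Lemma tr_adjmx n (M : 'M[C]_n) : \tr (adjmx M) = Num.conj (\tr M).
Proof.
by rewrite /adjmx mxtrace_tr /mxtrace rmorph_sum; apply: eq_bigr => i _; rewrite mxE.
Qed.

Lemma psdmx_gram m n (G : 'M[C]_(m, n)) : psdmx (adjmx G *m G).
Proof.
split; first by rewrite adjmxM adjmxK.
move=> v.
rewrite mulmxA -mulmxA.
have -> : G *m adjmx v = adjmx (v *m adjmx G) by rewrite adjmxM adjmxK.
by rewrite mxE sumr_ge0 // => i _; rewrite !mxE mul_conjC_ge0.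
Qed.

(** By the spectral theorem [M] is adj(P) D P with P unitary, and G is the square root of D times P.
    Positivity of Kronecker products, conjugates and traces reduces to this form. *)
Lemma psdmx_factor n (M : 'M[C]_n) :
  psdmx M -> exists G : 'M[C]_n, M = adjmx G *m G.
Proof.
move=> [hM pM].
have hh : M \is hermsymmx by apply/is_hermitianmxP; rewrite expr0 scale1r -map_trmx.
have /orthomx_spectralP eM := hermitian_normalmx hh.
set P := spectralmx M in eM; set d := spectral_diag M in eM.
have uP := spectral_unitarymx M.
have iP : invmx P = adjmx P by rewrite invmx_unitary // /adjmx map_trmx.
have uPE : P *m adjmx P = 1%:M by rewrite -iP mulmxV // spectral_unit.
(* The [i]-th eigenvalue is the value of the quadratic form of [M] at the [i]-th row of [P]. *)
have d_ge0 i : 0 <= d 0 i.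
  have := pM (row i P).
  rewrite {1}eM iP !mulmxA -row_mul uPE.
  have -> : row i 1%:M *m diag_mx d *m P *m adjmx (row i P) =
    row i 1%:M *m diag_mx d *m col i (P *m adjmx P).
    rewrite colE -!mulmxA; congr (_ *m (_ *m (_ *m _)));
    by apply/matrixP => a b; rewrite -colE !mxE.
  rewrite uPE -row_mul mul1mx mxE (bigD1 i) //= big1 ?addr0 => [|j ji].
    by rewrite !mxE eqxx mulr1 mulr1n.
  by rewrite !mxE (negbTE ji) mulr0.
exists (diag_mx (map_mx sqrtC d) *m P).
rewrite adjmxM mulmxA -(mulmxA (adjmx P)).
have -> : adjmx (diag_mx (map_mx sqrtC d)) *m diag_mx (map_mx sqrtC d) = diag_mx d.
  apply/matrixP => i j; rewrite mul_mx_diag !mxE.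
  have [->|ij] := eqVneq i j; last by rewrite ?mulr0n rmorph0 mul0r.
  rewrite ?eqxx ?mulr1n conj_Creal ?ger0_real ?sqrtC_ge0 //.
  by rewrite -expr2 sqrtCK.
by rewrite -iP.
Qed.

Lemma psdmx_kron m n (A : 'M[C]_m) (B : 'M[C]_n) :
  psdmx A -> psdmx B -> psdmx (kron A B).
Proof.
move=> /psdmx_factor[G ->] /psdmx_factor[H ->].
by rewrite -kron_mulmx -adjmx_kron; apply: psdmx_gram.
Qed.

Lemma psdmx1 n : psdmx (1%:M : 'M[C]_n).
Proof. by rewrite -[1%:M]mulmx1 -{1}(adjmx1 n); apply: psdmx_gram. Qed.

Lemma psdmx_conj m n (X : 'M[C]_(m, n)) (M : 'M[C]_n) :
  psdmx M -> psdmx (X *m M *m adjmx X).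
Proof.
move=> /psdmx_factor[G ->].
rewrite !mulmxA -mulmxA -[X *m adjmx G]adjmxK adjmxM adjmxK.
exact: psdmx_gram.
Qed.

Lemma psdmxD n (M N : 'M[C]_n) : psdmx M -> psdmx N -> psdmx (M + N).
Proof.
move=> [hM pM] [hN pN]; split; [by rewrite adjmxD -hM -hN | move=> v].
by rewrite mulmxDr mulmxDl mxE addr_ge0.
Qed.

Lemma psdmx0 n : psdmx (0 : 'M[C]_n).
Proof.
by rewrite -(mulmx0 _ (adjmx (0 : 'M[C]_n))); apply: psdmx_gram.
Qed.

Lemma psdmx_sum (I : Type) (r : seq I) (P : pred I) n (M : I -> 'M[C]_n) :
  (forall i, P i -> psdmx (M i)) -> psdmx (\sum_(i <- r | P i) M i).
Proof.
by move=> h; apply: big_ind => //; [apply: psdmx0 | apply: psdmxD].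
Qed.

Lemma psdmx_tr_ge0 n (M : 'M[C]_n) : psdmx M -> 0 <= \tr M.
Proof.
move=> /psdmx_factor[G ->]; apply: sumr_ge0 => i _.
by rewrite mxE sumr_ge0 // => j _; rewrite !mxE mulrC mul_conjC_ge0.
Qed.

Lemma psdmx_trM_ge0 n (M N : 'M[C]_n) : psdmx M -> psdmx N -> 0 <= \tr (M *m N).
Proof.
move=> pM /psdmx_factor[G ->].
rewrite mulmxA mxtrace_mulC mulmxA -[G in X in _ <= X]adjmxK.
by rewrite psdmx_tr_ge0 // adjmxK; apply: psdmx_conj.
Qed.

End Matrices.

(* sform and prob are locked to keep ring and lra from unfolding them when they
   compare atoms. *)
HB.lock Definition sform (R : realType) n (rho X Y : 'M[R[i]]_n) : R :=
  complex.Re (\tr (X *m rho *m adjmx Y)).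

(** * Observables and the seminorm of a state *)

Section Form.
Variable R : realType.
Local Notation C := R[i].
Local Notation Re := (@complex.Re R).

Lemma ReD (x y : C) : Re (x + y) = Re x + Re y.
Proof. by case: x y => [? ?] [? ?]. Qed.

Lemma ReN (x : C) : Re (- x) = - Re x.
Proof. by case: x. Qed.

Lemma Re_tr_sum n I (r : seq I) P (M : I -> 'M[C]_n) :
  Re (\tr (\sum_(i <- r | P i) M i)) = \sum_(i <- r | P i) Re (\tr (M i)).
Proof.
apply: (big_morph (fun M : 'M[C]_n => Re (\tr M))) => [M' N'|].
  by rewrite mxtraceD ReD.
by rewrite mxtrace0.
Qed.

Lemma ReZ (r : R) (x : C) : Re (real_complex R r * x) = r * Re x.
Proof. by case: x => a b /=; rewrite mul0r subr0. Qed.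

Lemma Re_ge0 (x : C) : 0 <= x -> 0 <= Re x.
Proof. by rewrite lecE => /andP[]. Qed.

Lemma Re_conj (x : C) : Re (Num.conj x) = Re x.
Proof. by case: x. Qed.

(** Unlike [mxE], these rules leave matrix products intact, so that [ring] can treat their entries
    as atoms. *)
Lemma mx_linE m n :
  (forall (A B : 'M[C]_(m, n)) i j, (A + B) i j = A i j + B i j) *
  (forall (A : 'M[C]_(m, n)) i j, (- A) i j = - A i j) *
  (forall c (A : 'M[C]_(m, n)) i j, (c *: A) i j = c * A i j).
Proof. by do !split; move=> *; rewrite mxE. Qed.

(** The measurement need not be projective, so the square of an observable is bounded by the
    identity rather than equal to it. *)
Definition observable n (Z : 'M[C]_n) :=
  exists E : bool -> 'M[C]_n, povm E /\ Z = E false - E true.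

Lemma povm_kronl (I : finType) m n (E : I -> 'M[C]_m) :
  povm E -> povm (fun i => kron (E i) (1%:M : 'M[C]_n)).
Proof.
move=> [pE sE]; split=> [i|]; first exact/psdmx_kron/psdmx1.
by rewrite -kron_suml sE kron11.
Qed.

Lemma povm_kronr (I : finType) m n (E : I -> 'M[C]_n) :
  povm E -> povm (fun i => kron (1%:M : 'M[C]_m) (E i)).
Proof.
move=> [pE sE]; split=> [i|]; first exact/psdmx_kron/pE/psdmx1.
by rewrite -kron_sumr sE kron11.
Qed.

Lemma observable_kronl m n (Z : 'M[C]_m) :
  observable Z -> observable (kron Z (1%:M : 'M[C]_n)).
Proof.
by move=> [E [/(povm_kronl n) pE ->]]; exists (fun i => kron (E i) 1%:M); rewrite kronBl.
Qed.

Lemma observable_kronr m n (Z : 'M[C]_n) :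
  observable Z -> observable (kron (1%:M : 'M[C]_m) Z).
Proof.
by move=> [E [/(povm_kronr m) pE ->]]; exists (fun i => kron 1%:M (E i)); rewrite kronBr.
Qed.

Lemma observable_adjmx n (Z : 'M[C]_n) : observable Z -> adjmx Z = Z.
Proof. by move=> [E [[pE _] ->]]; rewrite adjmxB -(pE false).1 -(pE true).1. Qed.

(** Since F + G = 1, the two elements commute and 1 - (F - G)^2 = 4 F G. Moreover F G = F G F + G F
    G, a sum of conjugates of positive semidefinite matrices. *)
Lemma observable_sqr_le1 n (Z : 'M[C]_n) : observable Z -> psdmx (1%:M - Z *m Z).
Proof.
move=> [E [[pE]]]; rewrite big_bool /= => sE ->.
set F := E false; set G := E true.
have eG : G = 1%:M - F by rewrite -sE addrK.
have -> : 1%:M - (F - G) *m (F - G) =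
    (F *m G *m F + G *m F *m G) + (F *m G *m F + G *m F *m G) +
    ((F *m G *m F + G *m F *m G) + (F *m G *m F + G *m F *m G)).
  rewrite eG !(mulmxBl, mulmxBr, mulmx1, mul1mx, mulmxA).
  by apply/matrixP => i j; rewrite !mx_linE; ring.
have h : psdmx (F *m G *m F + G *m F *m G).
  have hF : F = adjmx F := (pE false).1; have hG : G = adjmx G := (pE true).1.
  by apply: psdmxD; [rewrite {2}hF | rewrite {2}hG]; apply: psdmx_conj (pE _).
exact: psdmxD (psdmxD h h) (psdmxD h h).
Qed.

Variables (n : nat) (rho : 'M[C]_n).
Hypothesis rho_psd : psdmx rho.

Local Notation sform := (sform rho).
Local Notation sqn X := (sform X X).

Lemma sformDl X X' Y : sform (X + X') Y = sform X Y + sform X' Y.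
Proof. by rewrite sform.unlock !mulmxDl mxtraceD ReD. Qed.

Lemma sformDr X Y Y' : sform X (Y + Y') = sform X Y + sform X Y'.
Proof. by rewrite sform.unlock adjmxD mulmxDr mxtraceD ReD. Qed.

Lemma sformNl X Y : sform (- X) Y = - sform X Y.
Proof. by rewrite sform.unlock !mulNmx linearN ReN. Qed.

Lemma sformNr X Y : sform X (- Y) = - sform X Y.
Proof. by rewrite sform.unlock adjmxN mulmxN linearN ReN. Qed.

Lemma sformZl r X Y : sform (real_complex R r *: X) Y = r * sform X Y.
Proof. by rewrite sform.unlock -!scalemxAl mxtraceZ ReZ. Qed.

Lemma sformC X Y : sform X Y = sform Y X.
Proof.
rewrite sform.unlock -(Re_conj (\tr (X *m _ *m _))) -tr_adjmx !adjmxM adjmxK.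
by rewrite -rho_psd.1 mulmxA.
Qed.

Lemma sformZr r X Y : sform X (real_complex R r *: Y) = r * sform X Y.
Proof. by rewrite sformC sformZl sformC. Qed.

Lemma sqn_ge0 X : 0 <= sqn X.
Proof. by rewrite sform.unlock; apply/Re_ge0/psdmx_tr_ge0/psdmx_conj. Qed.

Lemma sqnN X : sqn (- X) = sqn X.
Proof. by rewrite sformNl sformNr opprK. Qed.

Lemma sqnZ r X : sqn (real_complex R r *: X) = r ^+ 2 * sqn X.
Proof. by rewrite sformZl sformZr mulrA. Qed.

Lemma sqn_addE X Y : sqn (X + Y) = sqn X + 2 * sform X Y + sqn Y.
Proof. by rewrite !(sformDl, sformDr) (sformC Y X); ring. Qed.

Lemma sqn_subE X Y : sqn (X - Y) = sqn X - 2 * sform X Y + sqn Y.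
Proof. by rewrite sqn_addE sformNr sqnN; ring. Qed.

Lemma sqn_add_le X Y : sqn (X + Y) <= 2 * sqn X + 2 * sqn Y.
Proof. by have := sqn_ge0 (X - Y); rewrite sqn_subE sqn_addE; lra. Qed.

Lemma sqn_sub_le X Y : sqn (X - Y) <= 2 * sqn X + 2 * sqn Y.
Proof. by rewrite -(sqnN Y) sqn_add_le. Qed.

(** The loss is the trace of the product of the positive semidefinite matrices 1 - Z Z and X rho
    adj(X). *)
Lemma sqn_contract Z X : observable Z -> sqn (Z *m X) <= sqn X.
Proof.
move=> oZ; rewrite -subr_ge0.
have -> : sqn X - sqn (Z *m X) =
    Re (\tr ((1%:M - Z *m Z) *m (X *m rho *m adjmx X))).
  rewrite mulmxBl mul1mx linearB ReD ReN sform.unlock; congr (_ - Re _).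
  by rewrite adjmxM (observable_adjmx oZ) !mulmxA mxtrace_mulC !mulmxA.
exact/Re_ge0/psdmx_trM_ge0/psdmx_conj/rho_psd/observable_sqr_le1.
Qed.

Hypothesis rho_tr : \tr rho = 1.

Lemma sqn1 : sqn 1%:M = 1.
Proof. by rewrite sform.unlock mul1mx adjmx1 mulmx1 rho_tr. Qed.

Lemma sqn_observable_le1 Z : observable Z -> sqn Z <= 1.
Proof. by move=> /(@sqn_contract Z 1%:M); rewrite mulmx1 sqn1. Qed.

(** The cross term with the identity is [sqn Z], which also bounds the seminorm of Z Z by
    contraction. *)
Lemma sqn_sqr_sub1_le Z : observable Z -> sqn (Z *m Z - 1%:M) <= 1 - sqn Z.
Proof.
move=> oZ; rewrite sqn_subE sqn1.
have -> : sform (Z *m Z) 1%:M = sqn Z.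
  rewrite sform.unlock adjmx1 mulmx1 (observable_adjmx oZ) -!mulmxA mxtrace_mulC.
  by rewrite !mulmxA.
by have := sqn_contract Z oZ; lra.
Qed.

End Form.

(** * CHSH rigidity and monogamy of correlations *)

Section Rigidity.
Variable R : realType.
Local Notation C := R[i].
Local Notation Re := (@complex.Re R).
Variables (n : nat) (rho : 'M[C]_n).
Hypothesis rho_density : density rho.
Local Notation sform := (sform rho).
Local Notation sqn X := (sform X X).
Let rho_psd := rho_density.1.
Let rho_tr := rho_density.2.

Lemma chsh_rigidity (A0 A1 S0 S1 : 'M[C]_n) (r := Num.sqrt 2 : R)
    (eta := 4 - r * (sform A0 S0 + sform A0 S1 + sform A1 S0 - sform A1 S1)) :
  observable A0 -> observable A1 -> observable S0 -> observable S1 ->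
  A0 *m S0 = S0 *m A0 -> A1 *m S0 = S0 *m A1 ->
  [/\ 0 <= eta, sqn (A1 *m A1 - 1%:M) <= eta
    & sqn (A0 *m A1 + A1 *m A0) <= 96 * eta].
Proof.
move=> oA0 oA1 oS0 oS1 cA0 cA1.
have r2 : r ^+ 2 = 2 by rewrite sqr_sqrtr.
pose c := real_complex R r.
have c2 : c * c = 2 by rewrite -rmorphM -expr2 r2 rmorph_nat.
pose D0 := c *: S0 - (A0 + A1); pose D1 := c *: S1 - (A0 - A1).
have D0E : sqn D0 = 2 * sqn S0 - 2 * r * (sform A0 S0 + sform A1 S0) + sqn (A0 + A1).
  by rewrite sqn_subE // sqnZ // r2 sformZl sformDr !(sformC rho_psd S0); ring.
have D1E : sqn D1 = 2 * sqn S1 - 2 * r * (sform A0 S1 - sform A1 S1) + sqn (A0 - A1).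
  by rewrite sqn_subE // sqnZ // r2 sformZl sformDr sformNr !(sformC rho_psd S1); ring.
(* The sum of squares: [2 * eta] is a sum of nonnegative terms, so each of them is O(eta). The
   products of [A0] and [A1] cancel between the two squares. *)
have sos : sqn D0 + sqn D1 + 2 * ((1 - sqn A0) + (1 - sqn A1) + (1 - sqn S0)
    + (1 - sqn S1)) = 2 * eta.
  by rewrite D0E D1E sqn_addE // sqn_subE // /eta; ring.
have D0_ge0 := sqn_ge0 rho_psd D0; have D1_ge0 := sqn_ge0 rho_psd D1.
have lA0 := sqn_observable_le1 rho_psd rho_tr oA0.
have lA1 := sqn_observable_le1 rho_psd rho_tr oA1.
have lS0 := sqn_observable_le1 rho_psd rho_tr oS0.
have lS1 := sqn_observable_le1 rho_psd rho_tr oS1.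
have qA0 := sqn_sqr_sub1_le rho_psd rho_tr oA0.
have qA1 := sqn_sqr_sub1_le rho_psd rho_tr oA1.
have qS0 := sqn_sqr_sub1_le rho_psd rho_tr oS0.
have dA0 := sqn_contract rho_psd D0 oA0.
have dA1 := sqn_contract rho_psd D0 oA1.
have dS0 := sqn_contract rho_psd D0 oS0.
split; [by lra|by lra|].
have two2 : real_complex R 2 = 2 by rewrite rmorph_nat.
(* From c S0 = D0 + A0 + A1 and the commutation of [S0] with [A0] and [A1] follows 2 S0^2 - c S0 D0
   = (A0 + A1) D0 + (A0 + A1)^2. Subtracting A0^2 and A1^2 leaves the anticommutator. *)
have -> : A0 *m A1 + A1 *m A0 =
    ((real_complex R 2 *: (S0 *m S0 - 1%:M) - c *: (S0 *m D0)) -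
     (A0 *m D0 + A1 *m D0)) -
    ((A0 *m A0 - 1%:M) + (A1 *m A1 - 1%:M)).
  rewrite /D0 two2.
  rewrite !(mulmxBr, mulmxDr, mulmxDl, mulmxBl, =^~ scalemxAr, =^~ scalemxAl).
  rewrite !(scalerBr, scalerDr, scalerA) c2 cA0 cA1.
  by apply/matrixP => i j; rewrite !mx_linE; ring.
have h1 := sqn_sub_le rho_psd (real_complex R 2 *: (S0 *m S0 - 1%:M)) (c *: (S0 *m D0)).
have h2 := sqn_add_le rho_psd (A0 *m D0) (A1 *m D0).
have h3 := sqn_add_le rho_psd (A0 *m A0 - 1%:M) (A1 *m A1 - 1%:M).
rewrite !sqnZ // r2 in h1.
(* Each split of a sum costs a factor 2. In total this gives 32 times the [sqn] of [D0] and of S0^2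
   - 1, plus 4 times those of A0^2 - 1 and A1^2 - 1. By [sos] that is at most 64 eta, within the
   stated 96. *)
apply: le_trans (sqn_sub_le rho_psd _ _) _.
set X := real_complex R 2 *: _ - _ in h1 *.
set Y := A0 *m D0 + _ in h2 *.
have h4 := sqn_sub_le rho_psd X Y.
lra.
Qed.

(** Commuting [B] and [C'] that mimic [A0] and [A1] make these almost commute on the state. If they
    also almost anticommute, then A1 A0 almost vanishes there, although its seminorm is bounded
    below when A1^2 is close to 1. *)
Lemma monogamy (A0 A1 B C' : 'M[C]_n) (k : R) :
  observable A0 -> observable A1 -> observable B -> observable C' ->
  A0 *m C' = C' *m A0 -> A1 *m B = B *m A1 -> B *m C' = C' *m B ->
  1 - k <= sform A0 B -> 1 - k <= sform A1 C' ->
  1 <= 4 * sqn (A1 *m A1 - 1%:M) + sqn (A0 *m A1 + A1 *m A0) + 42 * k.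
Proof.
move=> oA0 oA1 oB oC cA0C cA1B cBC kB kC.
have lA0 := sqn_observable_le1 rho_psd rho_tr oA0.
have lA1 := sqn_observable_le1 rho_psd rho_tr oA1.
have lB := sqn_observable_le1 rho_psd rho_tr oB.
have lC := sqn_observable_le1 rho_psd rho_tr oC.
pose U := A0 - B; pose V := A1 - C'.
have UE : sqn U <= 2 * k by rewrite sqn_subE //; lra.
have VE : sqn V <= 2 * k by rewrite sqn_subE //; lra.
have B_ge : 1 - 2 * k <= sqn B.
  by have := sqn_ge0 rho_psd U; rewrite sqn_subE //; lra.
pose K := A0 *m A1 - A1 *m A0; pose T := A0 *m A1 + A1 *m A0.
(* Replacing the factor next to the state and commuting takes A0 A1 to A0 C' = C' A0 and on to C' B,
   and likewise A1 A0 to B C'. The two results agree. *)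
have KE : K = (A0 *m V - B *m V) + (C' *m U - A1 *m U).
  rewrite /K /U /V !mulmxBr cA0C cA1B cBC.
  by apply/matrixP => i j; rewrite !mx_linE; ring.
have qK : sqn K <= 32 * k.
  rewrite KE; apply: le_trans (sqn_add_le rho_psd _ _) _.
  have := sqn_sub_le rho_psd (A0 *m V) (B *m V).
  have := sqn_sub_le rho_psd (C' *m U) (A1 *m U).
  have := sqn_contract rho_psd V oA0; have := sqn_contract rho_psd V oB.
  have := sqn_contract rho_psd U oC; have := sqn_contract rho_psd U oA1.
  by lra.
have two2 : real_complex R 2 = 2 by rewrite rmorph_nat.
have qTK : 4 * sqn (A1 *m A0) <= 2 * sqn T + 2 * sqn K.
  have := sqn_sub_le rho_psd T K.
  have -> : T - K = real_complex R 2 *: (A1 *m A0).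
    rewrite two2; apply/matrixP => i j; rewrite !mx_linE; ring.
  by rewrite sqnZ // => h; lra.
(* A1^2 - 1 is controlled only directly on the state, so the chain runs through [B], which commutes
   with [A1]: B is close to B A1^2 = A1^2 B, hence to A1^2 A0. This carries the lower bound on
   [sqn B] over to A1 A0. *)
have BE : B = (A1 *m (A1 *m A0)) - (B *m (A1 *m A1 - 1%:M) + A1 *m (A1 *m U)).
  have e : A1 *m (A1 *m B) = B *m (A1 *m A1) by rewrite cA1B mulmxA cA1B mulmxA.
  rewrite /U !mulmxBr mulmx1 e.
  by apply/matrixP => i j; rewrite !mx_linE; ring.
have := sqn_sub_le rho_psd (A1 *m (A1 *m A0))
  (B *m (A1 *m A1 - 1%:M) + A1 *m (A1 *m U)); rewrite -BE.
have := sqn_add_le rho_psd (B *m (A1 *m A1 - 1%:M)) (A1 *m (A1 *m U)).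
have := sqn_contract rho_psd (A1 *m A0) oA1.
have := sqn_contract rho_psd (A1 *m A1 - 1%:M) oB.
have := sqn_contract rho_psd (A1 *m U) oA1; have := sqn_contract rho_psd U oA1.
by rewrite -/T; lra.
Qed.

End Rigidity.

(** * Winning probabilities of the two games *)

HB.lock Definition prob (R : realType) n (rho M : 'M[R[i]]_n) : R :=
  complex.Re (\tr (M *m rho)).

Section Games.
Variable R : realType.
Local Notation C := R[i].
Local Notation Re := (@complex.Re R).

Lemma probE n (rho M : 'M[C]_n) : prob rho M = Re (\tr (M *m rho)).
Proof. by rewrite prob.unlock. Qed.

Lemma prob_sum n (rho : 'M[C]_n) I (r : seq I) P (M : I -> 'M[C]_n) :
  prob rho (\sum_(i <- r | P i) M i) = \sum_(i <- r | P i) prob rho (M i).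
Proof. by rewrite probE mulmx_suml Re_tr_sum; apply: eq_bigr => i _; rewrite probE. Qed.

Lemma probB n (rho M N : 'M[C]_n) : prob rho (M - N) = prob rho M - prob rho N.
Proof. by rewrite !probE mulmxBl linearB ReD ReN. Qed.

Lemma prob_ge0 n (rho M : 'M[C]_n) : psdmx rho -> psdmx M -> 0 <= prob rho M.
Proof. by move=> hr hM; rewrite probE; apply/Re_ge0/psdmx_trM_ge0. Qed.

Lemma prob1 n (rho : 'M[C]_n) : density rho -> prob rho 1%:M = 1.
Proof. by move=> [_ h]; rewrite !probE mul1mx h. Qed.

Definition povm_obs n (E : bool -> 'M[C]_n) := E false - E true.

Lemma povm_obs_observable n (E : bool -> 'M[C]_n) :
  povm E -> observable (povm_obs E).
Proof. by exists E. Qed.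

Lemma sform_prob n (rho X Y : 'M[C]_n) : sform rho X Y = prob rho (adjmx Y *m X).
Proof. by rewrite sform.unlock probE mxtrace_mulC mulmxA. Qed.

Lemma sform_kron m n (rho : 'M[C]_(m * n)) (A : 'M[C]_m) (B : 'M[C]_n) :
  observable B -> sform rho (kron A 1%:M) (kron 1%:M B) = prob rho (kron A B).
Proof.
move=> oB; rewrite sform_prob adjmx_kron adjmx1 (observable_adjmx oB).
by rewrite kron_mulmx mulmx1 mul1mx.
Qed.

Lemma prob_kron_obs m n (rho : 'M[C]_(m * n)) E F :
  prob rho (kron (povm_obs E) (povm_obs F)) =
  prob rho (kron (E false) (F false)) - prob rho (kron (E false) (F true)) -
  prob rho (kron (E true) (F false)) + prob rho (kron (E true) (F true)).
Proof. by rewrite /povm_obs kronBl !kronBr !probB; ring. Qed.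

Lemma prob_kron_total (I J : finType) m n (rho : 'M[C]_(m * n))
    (E : I -> 'M[C]_m) (F : J -> 'M[C]_n) :
  density rho -> povm E -> povm F ->
  \sum_i \sum_j prob rho (kron (E i) (F j)) = 1.
Proof.
move=> hr [_ hE] [_ hF].
under eq_bigr do rewrite -prob_sum -kron_sumr hF.
by rewrite -prob_sum -kron_suml hE kron11 prob1.
Qed.

(** For given inputs the outcome probabilities sum to 1, so the players win with probability (1 + E
    x y) / 2, or (1 - E x y) / 2 when [x && y]. *)
Lemma chsh_winprobE dA dB (S : chsh_strategy R dA dB)
    (A := fun x => kron (povm_obs (chsh_A S x)) 1%:M)
    (B := fun y => kron 1%:M (povm_obs (chsh_B S y)))
    (E := fun x y => sform (chsh_rho S) (A x) (B y)) :
  chsh_valid S ->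
  chsh_winprob S = 1 / 2 +
    (E false false + E false true + E true false - E true true) / 8.
Proof.
move=> [hr [hA hB]].
pose p x y a b := prob (chsh_rho S) (kron (chsh_A S x a) (chsh_B S y b)).
have EE x y : E x y = p x y false false - p x y false true - p x y true false
    + p x y true true.
  by rewrite /E sform_kron ?prob_kron_obs //; apply: povm_obs_observable.
have T x y : \sum_a \sum_b p x y a b = 1.
  exact: prob_kron_total hr (hA x) (hB y).
have -> : chsh_winprob S = \sum_x \sum_y \sum_a \sum_b
    (if addb a b == x && y then 4^-1 else 0) * p x y a b.
  by do 4!apply: eq_bigr => ? _; rewrite /p probE.
rewrite !EE; move: p T {EE} => p T.
have := T false false; have := T false true; have := T true false; have := T true true.
rewrite !big_bool /=.
by lra.
Qed.

(** The Heisenberg picture: by cyclicity, the Kraus operators act on the effect [M] instead of the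
    state. *)
Lemma tr_apply_instr (S : finType) dA m n k (K : S -> 'I_k -> 'M[C]_(m, n)) s
    (rho : 'M[C]_(dA * n)) (A : 'M[C]_dA) (M : 'M[C]_m) :
  \tr (kron A M *m apply_instr K s rho) =
  \tr (kron A (\sum_(j < k) adjmx (K s j) *m M *m K s j) *m rho).
Proof.
rewrite /apply_instr mulmx_sumr kron_sumr mulmx_suml !linear_sum /=.
apply: eq_bigr => j _; rewrite !mulmxA mxtrace_mulC !mulmxA.
by rewrite adjmx_kron adjmx1 !kron_mulmx mulmx1 mul1mx.
Qed.

Lemma psdmx_apply_instr (S : finType) dA m n k (K : S -> 'I_k -> 'M[C]_(m, n)) s
    (rho : 'M[C]_(dA * n)) : psdmx rho -> psdmx (apply_instr K s rho).
Proof. by move=> hr; apply: psdmx_sum => j _; apply: psdmx_conj. Qed.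

(** No signalling: in the Heisenberg picture the instrument is unital, so Alice's statistics do not
    see it. *)
Lemma tr_instrument (S : finType) dA m n k (K : S -> 'I_k -> 'M[C]_(m, n))
    (rho : 'M[C]_(dA * n)) (A : 'M[C]_dA) : instrument K ->
  \tr (kron A 1%:M *m \sum_s apply_instr K s rho) = \tr (kron A 1%:M *m rho).
Proof.
move=> hK; rewrite mulmx_sumr linear_sum /=.
under eq_bigr do rewrite tr_apply_instr.
rewrite -linear_sum -mulmx_suml -kron_sumr; congr (\tr (kron _ _ *m _)).
rewrite -hK; apply: eq_bigr => s _; apply: eq_bigr => j _.
by rewrite mulmx1.
Qed.

Lemma density_instrument (S : finType) dA m n k (K : S -> 'I_k -> 'M[C]_(m, n))
    (rho : 'M[C]_(dA * n)) : instrument K -> density rho ->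
  density (\sum_s apply_instr K s rho).
Proof.
move=> hK [pr tr]; split.
  by apply: psdmx_sum => s _; apply: psdmx_apply_instr.
have := tr_instrument rho 1%:M hK.
by rewrite !kron11 !mul1mx tr.
Qed.

Lemma sum_option_bool (F : option bool -> R) :
  \sum_(u : option bool) F u = F None + F (Some true) + F (Some false).
Proof.
rewrite (bigD1 None) //= (bigD1 (Some true)) //= (bigD1 (Some false)) //=.
rewrite big1 ?addr0 ?addrA // => -[[]|] //=.
Qed.

Section Clone.
Variables (dA dB dBo dCh nK : nat) (S : clone_strategy R dA dB dBo dCh nK).
Hypothesis S_valid : clone_valid S.

(** For a bit [u], Barlie's instrument with its quantum output discarded is a measurement, so the
    test round is an ordinary CHSH game. *)
Definition clone_chsh := ChshStrategy (cl_rho S) (cl_A S)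
  (fun u s => \sum_(j < nK) adjmx (cl_K S (Some u) s j) *m cl_K S (Some u) s j).

Lemma clone_chsh_valid : chsh_valid clone_chsh.
Proof.
case: S_valid => hr [hA [hK _]]; split=> //; split=> // u; split.
  by move=> s; apply: psdmx_sum => j _; apply: psdmx_gram.
exact: hK.
Qed.

(** Averaging over [s] leaves one state of Alice, Bob and Charlie, on which the whole keep round is
    a measurement. *)
Definition keep_state := \sum_s apply_instr (cl_K S None) s (cl_rho S).

Lemma keep_state_density : density keep_state.
Proof. by case: S_valid => hr [_ [hK _]]; apply: density_instrument. Qed.

Definition guess x y z a b c : R :=
  prob keep_state (kron (cl_A S x a) (kron (cl_Bob S y b) (cl_Charlie S z c))).

Lemma guess_ge0 x y z a b c : 0 <= guess x y z a b c.
Proof.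
case: S_valid => _ [hA [_ [hB hC]]].
have [pA _] := hA x; have [pB _] := hB y; have [pC _] := hC z.
have [pr _] := keep_state_density.
exact: (prob_ge0 pr (psdmx_kron (pA a) (psdmx_kron (pB b) (pC c)))).
Qed.

Lemma guess_total x y z : \sum_a \sum_b \sum_c guess x y z a b c = 1.
Proof.
case: S_valid => _ [hA [_ [hB hC]]].
rewrite -(prob1 keep_state_density) -kron11 -(hA x).2 kron_suml prob_sum.
apply: eq_bigr => a _.
rewrite -kron11 -(hB y).2 kron_suml kron_sumr prob_sum.
apply: eq_bigr => b _.
by rewrite -(hC z).2 !kron_sumr prob_sum.
Qed.

Definition guess_success x := \sum_a guess x (Some x) (Some x) a a a.

Let score x u y z : R := \sum_a \sum_s \sum_b \sum_c
  (if clone_win x u a s y z b c then 1 else 0) *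
  prob (apply_instr (cl_K S u) s (cl_rho S))
    (kron (cl_A S x a) (kron (cl_Bob S y b) (cl_Charlie S z c))).

Lemma score_chsh x u y z : score x (Some u) y z =
  \sum_a \sum_s (if addb a s == x && u then 1 else 0) *
    prob (chsh_rho clone_chsh) (kron (chsh_A clone_chsh x a) (chsh_B clone_chsh u s)).
Proof.
case: S_valid => _ [_ [_ [hB hC]]].
apply: eq_bigr => a _; apply: eq_bigr => s _ /=.
under eq_bigr do rewrite -mulr_sumr -prob_sum -!kron_sumr (hC z).2.
rewrite -mulr_sumr -prob_sum -kron_sumr -kron_suml (hB y).2 kron11.
rewrite !probE tr_apply_instr.
have -> : \sum_(j < nK) adjmx (cl_K S (Some u) s j) *m 1%:M *m cl_K S (Some u) s j =
    chsh_B clone_chsh u s by apply: eq_bigr => j _; rewrite mulmx1.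
by [].
Qed.

(** For [None] the winning condition is constant in [s], so [false] stands in for it while the sum
    over [s] merges the branches into [keep_state]. *)
Lemma score_keep x y z : score x None y z =
  \sum_a \sum_b \sum_c
    (if clone_win x None a false y z b c then 1 else 0) * guess x y z a b c.
Proof.
apply: eq_bigr => a _; rewrite exchange_big; apply: eq_bigr => b _ /=.
rewrite exchange_big; apply: eq_bigr => c _ /=.
rewrite -mulr_sumr; congr (_ * _).
by rewrite /guess probE mulmx_sumr Re_tr_sum; apply: eq_bigr => s _; rewrite probE.
Qed.

(** A keep round in which [y] or [z] is bottom is always won. Bob and Charlie both learn [x] with
    probability (1 - al)^2, and then [guess_success x] decides. *)
Lemma clone_winprobE g al :
  clone_winprob g al S = g * chsh_winprob clone_chsh +
    (1 - g) * (1 - (1 - al) ^+ 2 *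
      (1 - (guess_success false + guess_success true) / 2)).
Proof.
have -> : clone_winprob g al S = \sum_x \sum_u 2^-1 * prob_u g u *
    \sum_y \sum_z prob_y al x y * prob_y al x z * score x u y z.
  apply: eq_bigr => x _; apply: eq_bigr => u _.
  rewrite mulr_sumr; apply: eq_bigr => y _.
  rewrite mulr_sumr; apply: eq_bigr => z _.
  rewrite !mulr_sumr; apply: eq_bigr => a _.
  rewrite !mulr_sumr; apply: eq_bigr => s _.
  rewrite !mulr_sumr; apply: eq_bigr => b _.
  by rewrite !mulr_sumr; apply: eq_bigr => c _; rewrite probE !mulrA.
have sN x z : score x None None z = 1.
  rewrite score_keep -[RHS](guess_total x None z).
  by do 3!apply: eq_bigr => ? _; rewrite mul1r.
have sS x y : score x None (Some y) None = 1.
  rewrite score_keep -[RHS](guess_total x (Some y) None).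
  by do 3!apply: eq_bigr => ? _; rewrite mul1r.
have sG x : score x None (Some x) (Some x) = guess_success x.
  rewrite score_keep /guess_success; apply: eq_bigr => a _.
  by rewrite !big_bool; case: a => /=; ring.
pose p x u a s :=
  prob (chsh_rho clone_chsh) (kron (chsh_A clone_chsh x a) (chsh_B clone_chsh u s)).
have sC x u y z : score x (Some u) y z =
    \sum_a \sum_s (if addb a s == x && u then 1 else 0) * p x u a s.
  exact: score_chsh.
have -> : chsh_winprob clone_chsh = \sum_x \sum_y \sum_a \sum_b
    (if addb a b == x && y then 4^-1 else 0) * p x y a b.
  by do 4!apply: eq_bigr => ? _; rewrite /p probE.
move: p score sC sN sS sG => p sc sC sN sS sG.
rewrite !big_bool /= !sum_option_bool !sN !sS /= !sG !sC !big_bool /=.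
by field.
Qed.

End Clone.
End Games.

(** * Trade-off between winning CHSH and guessing Alice's bit *)

Section CloneBound.
Variable R : realType.
Local Notation C := R[i].
Variables (dA dB dBo dCh nK : nat) (S : clone_strategy R dA dB dBo dCh nK).
Hypothesis S_valid : clone_valid S.

Lemma guess_success_le1 x : guess_success S x <= 1.
Proof.
rewrite -(guess_total S_valid x (Some x) (Some x)) /guess_success.
have g0 := guess_ge0 S_valid x (Some x) (Some x).
move: (guess S x (Some x) (Some x)) g0 => g g0.
have := (g0 true true false, g0 true false true, g0 true false false).
have := (g0 false true true, g0 false true false, g0 false false true).
by rewrite !big_bool /= => -[[? ?] ?] [[? ?] ?]; lra.
Qed.

(** The correlation is 2 Pr[a = b] - 1, and b = c = a implies a = b. Charlie's outcome is summed out
    in [F]. *)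
Lemma corr_bob x : 2 * guess_success S x - 1 <= prob (keep_state S)
  (kron (povm_obs (cl_A S x)) (kron (povm_obs (cl_Bob S (Some x))) 1%:M)).
Proof.
have [_ [_ [_ [_ /(_ (Some x)) [_ hC]]]]] := S_valid.
rewrite -[X in _ - X](guess_total S_valid x (Some x) (Some x)) /guess_success.
have g0 := guess_ge0 S_valid x (Some x) (Some x).
pose F b := kron (cl_Bob S (Some x) b) (1%:M : 'M[C]_dCh).
have -> : kron (povm_obs (cl_Bob S (Some x))) 1%:M = povm_obs F.
  by rewrite /povm_obs kronBl.
have FE a b : prob (keep_state S) (kron (cl_A S x a) (F b)) =
    \sum_c guess S x (Some x) (Some x) a b c.
  by rewrite /F -hC !kron_sumr prob_sum.
rewrite prob_kron_obs !FE.
move: (guess S x (Some x) (Some x)) g0 {FE} => g g0.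
have := (g0 true true false, g0 true false true, g0 true false false).
have := (g0 false true true, g0 false true false, g0 false false true).
by rewrite !big_bool /= => -[[? ?] ?] [[? ?] ?]; lra.
Qed.

Lemma corr_charlie x : 2 * guess_success S x - 1 <= prob (keep_state S)
  (kron (povm_obs (cl_A S x)) (kron 1%:M (povm_obs (cl_Charlie S (Some x))))).
Proof.
have [_ [_ [_ [/(_ (Some x)) [_ hB] _]]]] := S_valid.
rewrite -[X in _ - X](guess_total S_valid x (Some x) (Some x)) /guess_success.
have g0 := guess_ge0 S_valid x (Some x) (Some x).
pose F c := kron (1%:M : 'M[C]_dBo) (cl_Charlie S (Some x) c).
have -> : kron 1%:M (povm_obs (cl_Charlie S (Some x))) = povm_obs F.
  by rewrite /povm_obs kronBr.
have FE a c : prob (keep_state S) (kron (cl_A S x a) (F c)) =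
    \sum_b guess S x (Some x) (Some x) a b c.
  by rewrite /F -hB kron_suml kron_sumr prob_sum.
rewrite prob_kron_obs !FE.
move: (guess S x (Some x) (Some x)) g0 {FE} => g g0.
have := (g0 true true false, g0 true false true, g0 true false false).
have := (g0 false true true, g0 false true false, g0 false false true).
by rewrite !big_bool /= => -[[? ?] ?] [[? ?] ?]; lra.
Qed.

(** This links the two rounds: relations among Alice's operators, obtained from CHSH on the initial
    state, carry over to the keep state because her marginal is the same. *)
Lemma sform_keep_state (X : 'M[C]_dA) :
  sform (keep_state S) (kron X 1%:M) (kron X 1%:M) =
  sform (cl_rho S) (kron X 1%:M) (kron X 1%:M).
Proof.
have [_ [_ [hK _]]] := S_valid.
rewrite !sform_prob !adjmx_kron !adjmx1 !kron_mulmx !mulmx1 !probE.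
by rewrite tr_instrument.
Qed.

Lemma clone_chsh_tradeoff
    (eta := 4 - (8 * chsh_winprob (clone_chsh S) - 4) * Num.sqrt 2)
    (kappa := 1 - (guess_success S false + guess_success S true) / 2) :
  [/\ 0 <= eta, 0 <= kappa & 1 <= 100 * eta + 168 * kappa].
Proof.
(* The constants of the two rigidity lemmas combine to 100 = 4 + 96 and 168 = 42 * 4. *)
have fin (q t e k : R) : q <= e -> t <= 96 * e ->
    1 <= 4 * q + t + 42 * (4 * k) -> 1 <= 100 * e + 168 * k by lra.
have g0 := guess_success_le1 false; have g1 := guess_success_le1 true.
(* Each success probability p is at most 1, so a single input fails with probability at most twice
   the average [kappa], and 2 p - 1 loses at most 4 kappa. *)
have [hk k0 k1] : [/\ 0 <= kappa, 1 - 4 * kappa <= 2 * guess_success S false - 1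
    & 1 - 4 * kappa <= 2 * guess_success S true - 1].
  rewrite /kappa; move: (guess_success S false) (guess_success S true) g0 g1.
  by move=> q0 q1 g0 g1; split; lra.
have [hr [hA [_ [hB hC]]]] := S_valid.
have vC := clone_chsh_valid S_valid; have [_ [_ hS]] := vC.
pose a x := povm_obs (cl_A S x).
have oa x : observable (a x) by apply: povm_obs_observable.
pose s u := povm_obs (chsh_B (clone_chsh S) u).
have os u : observable (s u) by apply: povm_obs_observable.
have cAS x u : kron (a x) 1%:M *m kron 1%:M (s u) = kron 1%:M (s u) *m kron (a x) 1%:M.
  by rewrite !kron_mulmx !mulmx1 !mul1mx.
have [he hA1 hT] := chsh_rigidity hr (observable_kronl dB (oa false))
  (observable_kronl dB (oa true)) (observable_kronr dA (os false))
  (observable_kronr dA (os true)) (cAS false false) (cAS true false).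
pose E x u := sform (cl_rho S) (kron (a x) 1%:M) (kron 1%:M (s u)).
(* 8 w - 4 recovers the CHSH correlation from the winning probability w. *)
have etaE : eta = 4 - Num.sqrt 2 *
    (E false false + E false true + E true false - E true true).
  have wE : chsh_winprob (clone_chsh S) = 1 / 2 +
      (E false false + E false true + E true false - E true true) / 8.
    exact: chsh_winprobE vC.
  by rewrite /eta wE; move: (E) => e; field.
split=> //; first by rewrite etaE.
pose b := povm_obs (cl_Bob S (Some false)).
pose c := povm_obs (cl_Charlie S (Some true)).
have ob : observable b by apply: povm_obs_observable.
have oc : observable c by apply: povm_obs_observable.
have ob' := observable_kronl dCh ob; have oc' := observable_kronr dBo oc.
have hb := corr_bob false; have hc := corr_charlie true.
rewrite -/(a _) -/b -(sform_kron _ _ ob') in hb.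
rewrite -/(a _) -/c -(sform_kron _ _ oc') in hc.
have c1 : kron (a false) 1%:M *m kron 1%:M (kron 1%:M c) =
    kron 1%:M (kron (1%:M : 'M[C]_dBo) c) *m kron (a false) 1%:M.
  by rewrite !kron_mulmx !mulmx1 !mul1mx.
have c2 : kron (a true) 1%:M *m kron 1%:M (kron b 1%:M) =
    kron 1%:M (kron b (1%:M : 'M[C]_dCh)) *m kron (a true) 1%:M.
  by rewrite !kron_mulmx !mulmx1 !mul1mx.
have c3 : kron (1%:M : 'M[C]_dA) (kron b 1%:M) *m kron 1%:M (kron 1%:M c) =
    kron 1%:M (kron 1%:M c) *m kron 1%:M (kron b 1%:M).
  by rewrite !kron_mulmx !mulmx1 !mul1mx.
have hb' : 1 - 4 * kappa <= sform (keep_state S) (kron (a false) 1%:M)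
    (kron 1%:M (kron b 1%:M)) by exact: le_trans k0 hb.
have hc' : 1 - 4 * kappa <= sform (keep_state S) (kron (a true) 1%:M)
    (kron 1%:M (kron 1%:M c)) by exact: le_trans k1 hc.
have := monogamy (keep_state_density S_valid)
  (observable_kronl _ (oa false)) (observable_kronl _ (oa true))
  (observable_kronr _ ob') (observable_kronr _ oc') c1 c2 c3 hb' hc'.
have kA m : kron (a true) (1%:M : 'M[C]_m) *m kron (a true) 1%:M - 1%:M =
    kron (a true *m a true - 1%:M) 1%:M.
  by rewrite [RHS]kronBl kron11 kron_mulmx mulmx1.
have kT m : kron (a false) (1%:M : 'M[C]_m) *m kron (a true) 1%:M +
    kron (a true) 1%:M *m kron (a false) 1%:M =
    kron (a false *m a true + a true *m a false) 1%:M.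
  by rewrite [RHS]kronDl !kron_mulmx !mulmx1.
rewrite kA kT !sform_keep_state; apply: fin.
  by rewrite etaE -kA; apply: hA1.
by rewrite etaE -kT; apply: hT.
Qed.

End CloneBound.

(** * An optimal CHSH strategy and Tsirelson's bound *)

Section ChshValue.
Variable R : realType.
Local Notation C := R[i].

(** In terms of Pauli matrices, this is c Z + s X. *)
Definition reflection (c s : R) : 'M[C]_2 :=
  \matrix_(i, j) real_complex R
    (if i == 0 then if j == 0 then c else s else if j == 0 then s else - c).

(** For c^2 + s^2 = 1 these are the spectral projections of the reflection, with [b = false] for the
    eigenvalue 1. *)
Definition reflection_povm (c s : R) (b : bool) : 'M[C]_2 :=
  2^-1 *: (1%:M + (-1) ^+ b *: reflection c s).

Lemma reflection_obs c s : povm_obs (reflection_povm c s) = reflection c s.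
Proof.
by apply/matrixP => i j; rewrite /povm_obs /reflection_povm !mxE /= expr0 expr1; field.
Qed.

Lemma adjmx_reflection c s : adjmx (reflection c s) = reflection c s.
Proof.
apply/matrixP => i j; rewrite !mxE; set x := (if _ then _ else _).
set y := (if _ then _ else _); have -> : y = x.
  by rewrite /x /y; case: (i == 0); case: (j == 0).
by rewrite conj_Creal // complex_real.
Qed.

Lemma reflection_sqr c s : c ^+ 2 + s ^+ 2 = 1 ->
  reflection c s *m reflection c s = 1%:M.
Proof.
move=> h; apply/matrixP => -[[|[|i]] hi] [[|[|j]] hj] //;
rewrite !mxE !big_ord_recl big_ord0 !mxE /= addr0 -!rmorphM -rmorphD /=.
- by rewrite -!expr2 h rmorph1.
- by rewrite mulrN mulrC subrr rmorph0.
- by rewrite mulNr mulrC subrr rmorph0.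
- by rewrite mulrNN -!expr2 addrC h rmorph1.
Qed.

Lemma reflection_povmP c s : c ^+ 2 + s ^+ 2 = 1 -> povm (reflection_povm c s).
Proof.
move=> h; split=> [b|]; last first.
  rewrite big_bool /= /reflection_povm expr0 expr1.
  rewrite -scalerDr addrACA scaleN1r scale1r addNr addr0 scalerDr -scalerDl.
  by have -> : 2^-1 + 2^-1 = 1 :> C; [field | rewrite scale1r].
(* A self-adjoint idempotent is its own Gram matrix. *)
suff -> : reflection_povm c s b =
    adjmx (reflection_povm c s b) *m reflection_povm c s b by apply: psdmx_gram.
have -> : adjmx (reflection_povm c s b) = reflection_povm c s b.
  rewrite adjmxZ adjmxD adjmxZ adjmx1 adjmx_reflection.
  have -> : Num.conj (2^-1 : C) = 2^-1 by apply: conj_Creal; rewrite realV realn.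
  have -> // : Num.conj ((-1) ^+ b : C) = (-1) ^+ b.
  by apply: conj_Creal; rewrite realX // realN real1.
rewrite /reflection_povm -scalemxAl -scalemxAr.
rewrite !(mulmxDl, mulmxDr, mulmx1, mul1mx, =^~ scalemxAl, =^~ scalemxAr).
rewrite (reflection_sqr h) scalerA -expr2 sqrr_sign.
move: (reflection c s) => M; apply/matrixP => i j; rewrite !mx_linE.
by move: (1%:M i j) (M i j) ((-1) ^+ b) => x y z; field.
Qed.

(** The maximally entangled state (|00> + |11>) / sqrt 2. *)
Definition epr_vec : 'M[C]_(1, 2 * 2) :=
  \row_k (real_complex R (Num.sqrt 2 / 2) * ((kidx k).1 == (kidx k).2)%:R).

Definition epr := adjmx epr_vec *m epr_vec.

Lemma eprE k l : epr k l =
  2^-1 * ((kidx k).1 == (kidx k).2)%:R * ((kidx l).1 == (kidx l).2)%:R.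
Proof.
rewrite mxE big_ord1 !mxE rmorphM /= rmorph_nat conj_Creal ?complex_real //.
rewrite mulrACA -rmorphM /= mulrACA -expr2 sqr_sqrtr // mulrA; congr (_ * _ * _).
have -> : (2 * (2^-1 * 2^-1) : R) = 2^-1 by field.
by rewrite fmorphV rmorph_nat.
Qed.

(** The right-hand side is half the trace of A times the transpose of B. *)
Lemma tr_epr (A B : 'M[C]_2) :
  \tr (kron A B *m epr) = 2^-1 * \sum_i \sum_j A i j * B i j.
Proof.
transitivity (\sum_(k < 2 * 2) \sum_(l < 2 * 2) A (kidx k).1 (kidx l).1 *
    B (kidx k).2 (kidx l).2 *
    (2^-1 * ((kidx l).1 == (kidx l).2)%:R * ((kidx k).1 == (kidx k).2)%:R)).
  by apply: eq_bigr => k _; rewrite mxE; apply: eq_bigr => l _; rewrite eprE mxE.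
rewrite (sum_kidx (fun k1 k2 => \sum_(l < 2 * 2) A k1 (kidx l).1 *
    B k2 (kidx l).2 * (2^-1 * ((kidx l).1 == (kidx l).2)%:R * (k1 == k2)%:R))).
rewrite mulr_sumr; apply: eq_bigr => i _.
rewrite [LHS](bigD1 i) //= [X in _ + X = _]big1 ?addr0 => [|j ji]; last first.
  by rewrite eq_sym (negbTE ji) big1 // => l _; rewrite !mulr0.
rewrite eqxx (sum_kidx (fun l1 l2 => A i l1 * B i l2 * (2^-1 * (l1 == l2)%:R * 1))).
rewrite mulr_sumr; apply: eq_bigr => j _.
rewrite [LHS](bigD1 j) //= [X in _ + X = _]big1 ?addr0 => [|k kj]; last first.
  by rewrite eq_sym (negbTE kj) mulr0 mul0r mulr0.
by rewrite eqxx !mulr1 mulrC.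
Qed.

Lemma prob_epr_reflection c s c' s' :
  prob epr (kron (reflection c s) (reflection c' s')) = c * c' + s * s'.
Proof.
rewrite probE tr_epr.
suff -> : 2^-1 * \sum_i \sum_j reflection c s i j * reflection c' s' i j =
  real_complex R (c * c' + s * s') by [].
rewrite !big_ord_recl !big_ord0 !mxE /= -!rmorphM !addr0 -!rmorphD /= mulrNN.
have -> : (2^-1 : C) = real_complex R 2^-1 by rewrite fmorphV rmorph_nat.
by rewrite -rmorphM; congr real_complex_def; field.
Qed.

Lemma epr_density : density epr.
Proof.
split; first exact: psdmx_gram.
have := tr_epr 1%:M 1%:M; rewrite kron11 mul1mx => ->.
by rewrite !big_ord_recl !big_ord0 !mxE /=; field.
Qed.

(** Alice measures Z or X, and Bob (Z + X) / sqrt 2 or (Z - X) / sqrt 2. *)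
Definition chsh_optimal := ChshStrategy epr
  (fun x => if x then reflection_povm 0 1 else reflection_povm 1 0)
  (fun y => let r := Num.sqrt 2 / 2 in reflection_povm r (if y then - r else r)).

Lemma sqr_half_sqrt2 : (Num.sqrt 2 / 2 : R) ^+ 2 = 2^-1.
Proof. by rewrite expr_div_n sqr_sqrtr //; field. Qed.

Lemma chsh_optimal_valid : chsh_valid chsh_optimal.
Proof.
split; first exact: epr_density.
split=> -[] /=; apply: reflection_povmP; rewrite ?sqrrN ?sqr_half_sqrt2; by field.
Qed.

Lemma chsh_optimal_winprob : chsh_winprob chsh_optimal = 1 / 2 + Num.sqrt 2 / 4.
Proof.
have [_ [_ hB]] := chsh_optimal_valid.
pose r : R := Num.sqrt 2 / 2.
have aE x : povm_obs (chsh_A chsh_optimal x) =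
    if x then reflection 0 1 else reflection 1 0.
  by case: x; apply: reflection_obs.
have bE y : povm_obs (chsh_B chsh_optimal y) = reflection r (if y then - r else r).
  exact: reflection_obs.
pose E x y := sform (chsh_rho chsh_optimal)
  (kron (povm_obs (chsh_A chsh_optimal x)) 1%:M)
  (kron 1%:M (povm_obs (chsh_B chsh_optimal y))).
have corr x y : E x y = if x && y then - r else r.
  rewrite /E (sform_kron _ _ (povm_obs_observable (hB y))) aE bE.
  by case: x; case: y; rewrite prob_epr_reflection; ring.
have -> : chsh_winprob chsh_optimal = 1 / 2 +
    (E false false + E false true + E true false - E true true) / 8.
  exact: chsh_winprobE chsh_optimal_valid.
by rewrite !corr /r; move: (Num.sqrt 2) => q /=; field.
Qed.

(** This is [0 <= eta] from [chsh_rigidity], divided by sqrt 2. *)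
Lemma tsirelson_bound dA dB (S : chsh_strategy R dA dB) :
  chsh_valid S -> chsh_winprob S <= 1 / 2 + Num.sqrt 2 / 4.
Proof.
move=> vS; rewrite (chsh_winprobE vS).
have [hr [hA hB]] := vS.
have oA x := observable_kronl dB (povm_obs_observable (hA x)).
have oB y := observable_kronr dA (povm_obs_observable (hB y)).
have cAB x y : kron (povm_obs (chsh_A S x)) 1%:M *m kron 1%:M (povm_obs (chsh_B S y))
    = kron 1%:M (povm_obs (chsh_B S y)) *m kron (povm_obs (chsh_A S x)) 1%:M.
  by rewrite !kron_mulmx !mulmx1 !mul1mx.
have [+ _ _] := chsh_rigidity hr (oA false) (oA true) (oB false) (oB true)
  (cAB false false) (cAB true false).
move: (_ + _ + _ - _) => X.
have := sqr_sqrtr (ler0n R 2); have := sqrtr_ge0 (2 : R).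
move: (Num.sqrt 2) => r r0 r2 h.
by nra.
Qed.

(** The value stands on the larger side of the theorem, which calls for a lower bound. Tsirelson's
    bound enters as the boundedness that [ub_le_sup] asks for. *)
Lemma chsh_qvalue_ge : 1 / 2 + Num.sqrt 2 / 4 <= chsh_qvalue R.
Proof.
apply: ub_le_sup; last first.
  exists 2, 2, chsh_optimal.
  by split; [apply: chsh_optimal_valid | rewrite chsh_optimal_winprob].
exists (1 / 2 + Num.sqrt 2 / 4) => p [dA [dB [S [vS ->]]]].
exact: tsirelson_bound.
Qed.

End ChshValue.

(** * The gap for the cloning game *)

Unset Implicit Arguments.

Theorem theorem18 (R : realType) (gamma alpha : R) :
  0 < gamma < 1 -> 0 < alpha < 1 ->
  exists delta : R, 0 < delta /\
    clone_qvalue gamma alpha <= (1 - gamma) + gamma * chsh_qvalue R - delta.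
Proof.
move=> /andP[g0 g1] /andP[a0 a1].
have w_ge := chsh_qvalue_ge R.
have r2 := sqr_sqrtr (ler0n R 2); have r0 : 0 < Num.sqrt 2 :> R by rewrite sqrtr_gt0.
move: (chsh_qvalue R) w_ge => w w_ge.
(* The losses in winning probability per unit of [kappa] and of [eta]. *)
pose c1 : R := (1 - gamma) * (1 - alpha) ^+ 2; pose c2 : R := gamma * Num.sqrt 2 / 16.
have c1_gt0 : 0 < c1 by rewrite mulr_gt0 ?exprn_gt0 ?subr_gt0.
have c2_gt0 : 0 < c2 by rewrite divr_gt0 ?mulr_gt0.
have c1_le : c1 <= 1 - gamma.
  by rewrite ler_piMr ?exprn_ile1 //; lra.
(* Chosen so that delta (100 eta + 168 kappa) <= c2 eta + c1 kappa, where the bracket is at least 1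
   by the trade-off. *)
pose delta : R := Num.min (c1 / 168) (c2 / 100).
have d1 : 168 * delta <= c1.
  by rewrite mulrC -ler_pdivlMr // ge_min lexx.
have d2 : 100 * delta <= c2.
  by rewrite mulrC -ler_pdivlMr // ge_min lexx orbT.
have d0 : 0 < delta by rewrite lt_min (divr_gt0 c1_gt0) ?(divr_gt0 c2_gt0).
exists delta; split=> //.
have gw : gamma * (1 / 2 + Num.sqrt 2 / 4) <= gamma * w by rewrite ler_pM2l.
rewrite /clone_qvalue; set E := (X in sup X).
(* The supremum of the empty set is 0 by convention, so in this case the right-hand side has to be
   nonnegative; this follows from delta <= c1 <= 1 - gamma. *)
have [->|/set0P E0] := eqVneq E set0.
  rewrite sup0; have : 0 <= gamma * w.
    by apply: le_trans gw; rewrite mulr_ge0 ?ltW //; lra.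
  by move: delta d0 d1 d2 c1_le => d *; lra.
apply: ge_sup => // p [dA [dB [dBo [dCh [nK [S [vS ->]]]]]]].
rewrite (clone_winprobE vS).
have [e0 k0 h] := clone_chsh_tradeoff vS.
set eta := 4 - _ in e0 h; set kappa := 1 - (guess_success S false + _) / 2 in k0 h *.
(* Inverts the definition of [eta], using that sqrt 2 squares to 2. *)
have -> : chsh_winprob (clone_chsh S) = 1 / 2 + Num.sqrt 2 / 4 - eta * Num.sqrt 2 / 16.
  rewrite /eta; move: (chsh_winprob _) (Num.sqrt 2) r2 => v r r2.
  have -> : (4 - (8 * v - 4) * r) * r / 16 = r / 4 - (8 * v - 4) * r ^+ 2 / 16 by field.
  by rewrite r2; field.
move: eta kappa e0 k0 h => eta kappa e0 k0 h.
have hd : delta <= c1 * kappa + c2 * eta.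
  have hs := lerD (ler_wpM2r k0 d1) (ler_wpM2r e0 d2).
  apply: (le_trans _ hs).
  have -> : 168 * delta * kappa + 100 * delta * eta =
    delta * (100 * eta + 168 * kappa) by ring.
  by rewrite ler_peMr // ltW.
have -> : gamma * (1 / 2 + Num.sqrt 2 / 4 - eta * Num.sqrt 2 / 16) +
    (1 - gamma) * (1 - (1 - alpha) ^+ 2 * kappa) =
    gamma * (1 / 2 + Num.sqrt 2 / 4) + (1 - gamma) - (c1 * kappa + c2 * eta).
  by rewrite /c1 /c2; field.
by move: (delta) (c1 * kappa + c2 * eta) hd => x y hd; lra.
Qed.
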